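(* For every positive integer $n$, the edge-labelling $\gamma$ of $NS_n$ (defined below) is an interpolating EL-labelling of $NS_n$.
   Context: $\Pi_n$ is the set of set partitions of $[n]=\{1,\dots,n\}$ ordered by refinement ($y\le z$ if every block of $y$ is contained in a block of $z$). A partition of $[n]$ is non-straddling if whenever a block $B$ contains $a$ and $d$ and a block $B'$ contains $b$ and $c$ with $a<b<c<d$, then $B=B'$. $NS_n$ is the subposet of $\Pi_n$ consisting of non-straddling partitions (it is a bounded lattice, with minimum the partition into singletons and maximum $\{[n]\}$). If $y\lessdot z$ is a cover in $NS_n$, then $z$ is obtained from $y$ by merging some blocks $B_1,\dots,B_r$ ($r\ge2$) of $y$ into a single block; set $\gamma(y,z)$ to be the second smallest element of $\{\min B_1,\dots,\min B_r\}$. An edge-labelling (map from covers to $\mathbb Z$) is an EL-labelling if for all $y<z$ there is a unique unrefinable chain from $y$ to $z$ with weakly increasing labels (the increasing chain), and its label sequence lexicographically precedes those of all other unrefinable chains from $y$ to $z$. It is interpolating if for every $y\lessdot u\lessdot z$, either $\gamma(y,u)<\gamma(u,z)$, or the increasing chain $y=w_0\lessdot\cdots\lessdot w_r=z$ has strictly increasing labels with $\gamma(w_0,w_1)=\gamma(u,z)$ and $\gamma(w_{r-1},w_r)=\gamma(y,u)$. *)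

(* Defs.v *)
From HB Require Import structures.
From mathcomp Require Import all_boot all_order all_algebra.

Set Implicit Arguments.
Unset Strict Implicit.
Unset Printing Implicit Defensive.

Import Order.TTheory GRing.Theory Num.Theory.

(* Edge-labellings of a finite poset are total functions T -> T -> int of which
   only the values g y z with covers y z are ever used. *)
Section EdgeLabelling.
Context {d : Order.disp_t} {T : finPOrderType d}.
Implicit Types (g : T -> T -> int) (y z u : T) (s t : seq T).

Definition covers y z : bool :=
  (y < z)%O && ~~ [exists u, (y < u)%O && (u < z)%O].

(* The chain y = w_0 <. w_1 <. ... <. w_r = z is encoded by its bottom y and
   the sequence s = [:: w_1; ...; w_r]. *)
Definition unrefinable_chain y z s : bool :=
  path covers y s && (last y s == z).

(* [:: g w_0 w_1; g w_1 w_2; ...; g w_(r-1) w_r] *)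
Definition labels g y s : seq int := pairmap g y s.

Definition increasing_chain g y z s : bool :=
  unrefinable_chain y z s && sorted (<=%O) (labels g y s).

Definition EL_labelling g : Prop :=
  forall y z, (y < z)%O ->
  exists s,
    [/\ increasing_chain g y z s,
        forall t, increasing_chain g y z t -> t = s
      & forall t, unrefinable_chain y z t -> t <> s ->
          ((labels g y s : seqlexi int) < (labels g y t : seqlexi int))%O].

Definition interpolating g : Prop :=
  forall y u z, covers y u -> covers u z ->
  (g y u < g u z)%O \/
  exists2 s, increasing_chain g y z s &
    [/\ sorted (<%O) (labels g y s),
        head 0%R (labels g y s) = g u z
      & last 0%R (labels g y s) = g y u].

Definition interpolating_EL_labelling g : Prop :=
  EL_labelling g /\ interpolating g.

End EdgeLabelling.

(* The ground set {1, ..., n} is represented by 'I_n, with i : 'I_n standing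
   for the integer i.+1. *)
Record set_partition (n : nat) := SetPartition {
  blocks :> {set {set 'I_n}};
  blocks_partition : partition blocks [set: 'I_n]
}.

HB.instance Definition _ n := [isSub for @blocks n].
HB.instance Definition _ n := [Finite of set_partition n by <:].

Section Refinement.
Variable n : nat.
Implicit Types y z w : set_partition n.

Definition refines y z : bool :=
  [forall B in blocks y, exists C in blocks z, B \subset C].

Fact refinesP y z :
  reflect (forall B, B \in blocks y -> exists2 C, C \in blocks z & B \subset C)
          (refines y z).
Proof.
apply: (iffP forall_inP) => h B /h; first by case/exists_inP=> C; exists C.
by case=> C Cz BC; apply/exists_inP; exists C.
Qed.

Fact refines_refl : reflexive refines.
Proof. by move=> y; apply/refinesP => B By; exists B. Qed.

Fact refines_sub y z : refines y z -> refines z y -> blocks y \subset blocks z.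
Proof.
move=> /refinesP yz /refinesP zy; apply/subsetP => B By.
have [C Cz BC] := yz B By; have [D Dy CD] := zy C Cz.
have /and3P[_ /trivIsetP tI n0] := blocks_partition y.
have eBD : B = D.
  apply/eqP; apply: contraT => /(tI _ _ By Dy).
  rewrite -setI_eq0 (setIidPl (subset_trans BC CD)) => /eqP B0.
  by rewrite -B0 By in n0.
suff -> : B = C by [].
by apply/eqP; rewrite eqEsubset BC eBD CD.
Qed.

Fact refines_anti : antisymmetric refines.
Proof.
move=> y z /andP[yz zy]; apply: val_inj.
by apply/eqP; rewrite eqEsubset (refines_sub yz zy) (refines_sub zy yz).
Qed.

Fact refines_trans : transitive refines.
Proof.
move=> z y w /refinesP yz /refinesP zw; apply/refinesP => B /yz[C /zw[D Dw CD] BC].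
by exists D => //; apply: subset_trans CD.
Qed.

End Refinement.

Fact refinement_display : Order.disp_t. Proof. exact: Order.Disp tt tt. Qed.

HB.instance Definition _ n :=
  Order.Le_isPOrder.Build refinement_display (set_partition n)
    (@refines_refl n) (@refines_anti n) (@refines_trans n).

Definition nonstraddling n (y : set_partition n) : bool :=
  [forall B in blocks y, forall B' in blocks y,
    [exists a in B, exists d in B, exists b in B', exists c in B',
      [&& (a < b)%N, (b < c)%N & (c < d)%N]] ==> (B == B')].

Record NS (n : nat) := MkNS {
  ns_partition :> set_partition n;
  ns_nonstraddling : nonstraddling ns_partition
}.

HB.instance Definition _ n := [isSub for @ns_partition n].
HB.instance Definition _ n := [Finite of NS n by <:].
HB.instance Definition _ n :=
  [SubChoice_isSubPOrder of NS n by <: with refinement_display].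

(* k counts from 0: k = 0 gives the minimum, k = 1 the second smallest value. *)
Definition kth_smallest (k : nat) (s : seq nat) : nat :=
  nth 0%N (sort leq (undup s)) k.

Definition block_min n (B : {set 'I_n}) : nat :=
  kth_smallest 0 [seq (nat_of_ord i).+1 | i in B].

(* When z is obtained from y by merging the blocks B_1, ..., B_r (r >= 2) into
   one, these are exactly the blocks of y that are not blocks of z. *)
Definition gamma n (y z : NS n) : int :=
  Posz (kth_smallest 1 [seq block_min B | B in blocks y :\: blocks z]).

(* Main.v *)
(* Call [i] lost in [y, z] if it is the minimum of a block of [y] but not of a
   block of [z]; on a cover, [gamma] is the least lost element (shifted by one),
   and the elements lost in [y, z] are distributed over the steps of any
   unrefinable chain.  Hence every such chain carries the label given by the least
   element [i] lost in [y, z], no label is smaller, and the unique increasing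
   chain starts with the join [w] of [y] with the two blocks of [y] of smallest
   minimum inside the [z]-block of [i].  That [w] covers [y], and that the last
   label of an increasing chain of a two-step interval is as required, both
   follow from a form of left modularity ([separator]): if [i] is the least
   element lost in [y, w], some [v >= y] puts all [j < i] in one block but leaves
   [i] a block minimum. *)
Require Import Defs.
From mathcomp Require Import all_boot all_order all_algebra.

Set Implicit Arguments.
Unset Strict Implicit.
Unset Printing Implicit Defensive.

Import Order.TTheory.

(** * Order statistics of a sequence of naturals *)

Lemma kth_smallest_0 (s : seq nat) a :
  a \in s -> (forall x, x \in s -> a <= x) -> kth_smallest 0 s = a.
Proof.
rewrite /kth_smallest => sa a_min.
have := sort_sorted leq_total (undup s); have mem := mem_sort leq (undup s).
case: (sort leq (undup s)) mem => [|x0 t] mem.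
  by have := mem a; rewrite mem_undup sa.
move=> /(order_path_min leq_trans)/allP x0_min /=.
have : a \in x0 :: t by rewrite mem mem_undup.
rewrite inE => /predU1P[//|/x0_min le_x0a].
apply/eqP; rewrite eqn_leq le_x0a a_min //.
by rewrite -mem_undup -mem inE eqxx.
Qed.

Lemma kth_smallest_1 (s : seq nat) a b :
    a \in s -> b \in s -> a < b -> (forall x, x \in s -> x = a \/ b <= x) ->
  kth_smallest 1 s = b.
Proof.
move=> sa sb ab ab_min; have a_min x : x \in s -> a <= x.
  by case/ab_min=> [->//|]; apply/leq_trans/ltnW.
have := kth_smallest_0 sa a_min; rewrite /kth_smallest.
have : sorted ltn (sort leq (undup s)).
  by rewrite ltn_sorted_uniq_leq sort_uniq undup_uniq sort_sorted //; apply: leq_total.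
have mem x : (x \in sort leq (undup s)) = (x \in s) by rewrite mem_sort mem_undup.
case: (sort leq (undup s)) mem => [|x0 [|x1 t]] /= mem; first by rewrite -mem in sa.
  by rewrite -mem inE in sb => _ x0a; rewrite -x0a (eqP sb) ltnn in ab.
move=> /andP[lt_x01 /(order_path_min ltn_trans)/allP x1_min] x0a.
have : b \in [:: x0, x1 & t] by rewrite mem.
rewrite !inE x0a gtn_eqF //= => /predU1P[//|/x1_min lt_x1b].
have : x1 \in s by rewrite -mem !inE eqxx orbT.
by case/ab_min => [x1a|]; [rewrite x0a x1a ltnn in lt_x01 | rewrite leqNgt lt_x1b].
Qed.

(** * Set partitions as equivalence relations *)

Section SameBlock.
Variable n : nat.
Implicit Types (y z : set_partition n) (a b c d i j k p q : 'I_n).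

Definition same y a b := b \in pblock (blocks y) a.

Lemma trivIset_blocks y : trivIset (blocks y).
Proof. by have /and3P[] := blocks_partition y. Qed.

Lemma in_cover_blocks y a : a \in cover (blocks y).
Proof. by have /and3P[/eqP-> _ _] := blocks_partition y; rewrite inE. Qed.

Lemma block_nonempty y B : B \in blocks y -> exists a, a \in B.
Proof.
move=> By; have /and3P[_ _ n0] := blocks_partition y.
by apply/set0Pn; apply: contraNneq n0 => <-.
Qed.

Lemma sameE y a b : same y a b = (pblock (blocks y) a == pblock (blocks y) b).
Proof. by rewrite eq_pblock ?trivIset_blocks ?in_cover_blocks. Qed.

Lemma same_refl y : reflexive (same y).
Proof. by move=> a; rewrite sameE. Qed.

Lemma same_sym y : symmetric (same y).
Proof. by move=> a b; rewrite !sameE eq_sym. Qed.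

Lemma same_trans y : transitive (same y).
Proof. by move=> b a c; rewrite !sameE => /eqP->. Qed.

Lemma same_left y a b c : same y a b -> same y a c = same y b c.
Proof. by rewrite !sameE => /eqP->. Qed.

Lemma same_block y B a b : B \in blocks y -> a \in B -> same y a b = (b \in B).
Proof. by move=> By aB; rewrite /same (def_pblock (trivIset_blocks y) By aB). Qed.

Lemma pblock_block y a : pblock (blocks y) a \in blocks y.
Proof. exact/pblock_mem/in_cover_blocks. Qed.

Lemma refines_same y z :
  reflect (forall a b, same y a b -> same z a b) (refines y z).
Proof.
apply: (iffP (refinesP y z)) => [yz a b ab | yz B By].
  have [C Cz BC] := yz _ (pblock_block y a).
  rewrite (same_block _ Cz) ?(subsetP BC) //.
  exact: same_refl.
have [a aB] := block_nonempty By.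
exists (pblock (blocks z) a); first exact: pblock_block.
by apply/subsetP => b bB; apply: yz; rewrite (same_block _ By).
Qed.

Definition block_least y a : bool := [forall b, same y a b ==> (a <= b)].

Lemma block_leastP y a :
  reflect (forall b, same y a b -> a <= b) (block_least y a).
Proof. by apply: (iffP forallP) => h b; apply/implyP; apply: h. Qed.

Lemma ex_block_least y a :
  exists p, [/\ same y p a, block_least y p & p <= a].
Proof.
case: (@arg_minnP _ a (same y a) (@nat_of_ord n) (same_refl y a)) => p ap p_min.
exists p; split; first by rewrite same_sym.
  by apply/block_leastP => b pb; apply: p_min; rewrite (same_left _ ap).
exact/p_min/same_refl.
Qed.

Lemma block_least_inj y a b :
  block_least y a -> block_least y b -> same y a b -> a = b.
Proof.
move=> /block_leastP a_min /block_leastP b_min ab.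
by apply/val_inj/eqP; rewrite eqn_leq a_min // b_min // same_sym.
Qed.

Lemma not_block_leastP y a :
  reflect (exists p, [/\ same y p a, block_least y p & p < a])
          (~~ block_least y a).
Proof.
apply: (iffP idP) => [nl | [p [pa _ lt_pa]]]; last first.
  apply: contraTN lt_pa => /block_leastP a_min.
  by rewrite -leqNgt a_min // same_sym.
have [p [pa lp le_pa]] := ex_block_least y a; exists p; split=> //.
by rewrite ltn_neqAle le_pa andbT; apply: contraNneq nl => /val_inj <-.
Qed.

Lemma refines_block_least y z a :
  refines y z -> block_least z a -> block_least y a.
Proof.
move=> /refines_same yz /block_leastP az; apply/block_leastP => b ab.
exact/az/yz.
Qed.

Lemma nonstraddlingP y :
  reflect (forall a b c d, a < b -> b < c -> c < d ->
             same y a d -> same y b c -> same y a b)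
          (nonstraddling y).
Proof.
apply: (iffP idP) => [ns a b c d ab bc cd ad bc' | ns].
  have /forall_inP/(_ _ (pblock_block y a)) := ns.
  move=> /forall_inP/(_ _ (pblock_block y b)) /implyP.
  rewrite sameE; apply; apply/exists_inP; exists a; first exact: same_refl.
  apply/exists_inP; exists d => //.
  apply/exists_inP; exists b; first exact: same_refl.
  by apply/exists_inP; exists c => //; apply/and3P.
apply/forall_inP => B By; apply/forall_inP => B' By'; apply/implyP.
case/exists_inP => a aB /exists_inP[d dB /exists_inP[b bB' /exists_inP[c cB']]].
case/and3P => ab bc cd; have := ns a b c d ab bc cd.
rewrite (same_block _ By aB) (same_block _ By' bB') => /(_ dB cB').
by rewrite sameE !(def_pblock (trivIset_blocks y) _ aB,
                   def_pblock (trivIset_blocks y) _ bB').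
Qed.

Section FromRelation.
Variables (e : rel 'I_n) (e_equiv : equivalence_rel e).

Let e_equiv_setT : {in [set: 'I_n] & &, equivalence_rel e}.
Proof. by move=> a b c _ _ _; apply: e_equiv. Qed.

Definition rel_partition : set_partition n :=
  SetPartition (equivalence_partitionP e_equiv_setT).

Lemma same_rel_partition a b : same rel_partition a b = e a b.
Proof. by rewrite /same pblock_equivalence_partition ?inE. Qed.

End FromRelation.

Lemma equiv_rel (e : rel 'I_n) :
  reflexive e -> symmetric e -> transitive e -> equivalence_rel e.
Proof. by move=> er es et; apply/equivalence_relP; split=> //; apply: left_trans. Qed.

End SameBlock.

Lemma block_min_pblock n (y : set_partition n) (a : 'I_n) :
  block_least y a -> block_min (pblock (blocks y) a) = a.+1.
Proof.
move=> /block_leastP a_min; apply: kth_smallest_0.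
  by apply/imageP; exists a => //; apply: same_refl.
by move=> _ /imageP[b ab ->]; rewrite ltnS; apply: a_min.
Qed.

(** * Meets and covers of non-straddling partitions *)

Section Poset.
Variable n : nat.
Implicit Types (u v w x y z : NS n) (a b c d i j k p q : 'I_n).

Lemma le_same y z :
  reflect (forall a b, same y a b -> same z a b) (y <= z)%O.
Proof. exact: refines_same. Qed.

Lemma same_nonstraddling y a b c d : a < b -> b < c -> c < d ->
  same y a d -> same y b c -> same y a b.
Proof. exact/nonstraddlingP/ns_nonstraddling. Qed.

Lemma ex_NS (e : rel 'I_n) :
    reflexive e -> symmetric e -> transitive e ->
    (forall a b c d, a < b -> b < c -> c < d -> e a d -> e b c -> e a b) ->
  exists x : NS n, same x =2 e.
Proof.
move=> er es et e_ns; have e_equiv := equiv_rel er es et.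
have ns : nonstraddling (rel_partition e_equiv).
  apply/nonstraddlingP => a b c d ab bc cd.
  by rewrite !same_rel_partition; apply: e_ns.
by exists (MkNS ns) => a b; rewrite same_rel_partition.
Qed.

Lemma ex_meet y z : exists x, same x =2 (fun a b => same y a b && same z a b).
Proof.
apply: ex_NS => [a|a b|b a c|a b c d ab bc cd].
- by rewrite !same_refl.
- by rewrite !(same_sym _ a).
- by case/andP=> ? ? /andP[? ?]; apply/andP; split; apply: (@same_trans _ _ b).
- case/andP=> yad zad /andP[ybc zbc].
  by rewrite !(same_nonstraddling ab bc cd).
Qed.

Lemma cover_le_eq y z x : covers y z -> (y < x)%O -> (x <= z)%O -> x = z.
Proof.
case/andP=> _ /existsPn/(_ x); rewrite negb_and => /orP[/negPf->//|nxz] yx.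
by rewrite le_eqVlt (negPf nxz) orbF => /eqP.
Qed.

Lemma cover_lt y z : covers y z -> (y < z)%O.
Proof. by case/andP. Qed.

(** The meet of [z] and [x] lies in [[y, z]] and differs from [y] because it joins [a] and [b]; the
    cover leaves only [z]. *)
Lemma cover_same y z x a b : covers y z -> (y <= x)%O ->
  ~~ same y a b -> same z a b -> same x a b -> (z <= x)%O.
Proof.
move=> yz /le_same yx nab zab xab.
have [m mE] := ex_meet z x.
have /le_same ylz := ltW (cover_lt yz).
suff <- : m = z by apply/le_same => c d; rewrite mE => /andP[].
apply: (cover_le_eq yz); last by apply/le_same => c d; rewrite mE => /andP[].
rewrite lt_neqAle; apply/andP; split; last first.
  by apply/le_same => c d ycd; rewrite mE ylz // yx.
by apply: contraNneq nab => ->; rewrite mE zab.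
Qed.

(** * Lost block minima *)

Definition lost y z i := block_least y i && ~~ block_least z i.

Definition first_lost y z i := lost y z i /\ forall j, lost y z j -> i <= j.

Lemma lost_widen y u w z i : (y <= u)%O -> (w <= z)%O ->
  lost u w i -> lost y z i.
Proof.
move=> yu wz /andP[ui wi]; rewrite /lost (refines_block_least yu ui) /=.
by apply: contraNN wi; apply: refines_block_least.
Qed.

(** Block minima never reappear under coarsening, so losses distribute over the steps of a chain. *)
Lemma lost_split y u z i : (y <= u)%O -> (u <= z)%O ->
  lost y z i = lost y u i || lost u z i.
Proof.
move=> yu uz; rewrite /lost; case ui: (block_least u i) => /=.
  by rewrite (refines_block_least yu ui) andbF.
rewrite andbT orbF; case zi: (block_least z i); last by rewrite andbT.
by rewrite (refines_block_least uz zi) in ui.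
Qed.

Lemma first_lost_rep y z i p : (y <= z)%O -> first_lost y z i ->
  block_least y p -> p < i -> block_least z p.
Proof.
move=> yz [_ i_min] yp pi; apply: contraTT pi => zp.
by rewrite -leqNgt i_min // /lost yp.
Qed.

(** If every block minimum survived, points joined in [z] would have the same minimum in [y], and so
    be joined there already. *)
Lemma ex_lost y z : (y < z)%O -> exists i, lost y z i.
Proof.
move=> yz; apply/existsP; apply: contraTT yz => /existsPn noloss.
rewrite lt_neqAle; apply/negP => /andP[/eqP nyz /[dup] yz /le_same yzs].
case: nyz; apply/le_anti; rewrite yz /=; apply/le_same => a b zab.
have keep p : block_least y p -> block_least z p.
  by move=> yp; have := noloss p; rewrite /lost yp /= negbK.
have [p [pa yp _]] := ex_block_least y a.
have [q [qb yq _]] := ex_block_least y b.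
have pq : p = q.
  apply: (block_least_inj (keep _ yp) (keep _ yq)).
  apply: (same_trans (yzs _ _ pa)); apply: (same_trans zab).
  by rewrite same_sym yzs.
by rewrite -(same_left _ pa) pq.
Qed.

Lemma ex_first_lost y z : (y < z)%O -> exists i, first_lost y z i.
Proof.
case/ex_lost => i0 li0.
case: (@arg_minnP _ i0 (lost y z) (@nat_of_ord n) li0) => i li mi.
by exists i.
Qed.

(** * Left modularity *)

(** The natural choice, merging all blocks of [y] that meet the elements below [i], may straddle. It
    works if the [w]-block of [i] extends beyond [i]; otherwise [i] is alone in its [y]-block and
    can be split off from everything else. *)
Lemma separator y w i : (y <= w)%O -> first_lost y w i ->
  exists v, [/\ (y <= v)%O, forall j k, j < i -> k < i -> same v j k
              & block_least v i].
Proof.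
move=> yw fi; have [/andP[yi /not_block_leastP[q [qi wq lt_qi]]] _] := fi.
have /le_same yws := yw; have /block_leastP yi_min := yi.
have [/existsP[D /andP[iD wiD]] | /existsPn noD] :=
  boolP [exists D : 'I_n, (i < D) && same w i D]; last first.
  have [v vE] : exists v : NS n, same v =2 (fun a b => (a == i) == (b == i)).
    apply: ex_NS => [a|a b|b a c /eqP->//|a b c d ab bc cd /eqP adi /eqP bci].
    - exact: eqxx.
    - exact: eq_sym.
    - have nbi : b == i = false.
        apply/eqP => bi; move: bci; rewrite bi eqxx => /esym/eqP ci.
        by rewrite bi ci ltnn in bc.
      rewrite nbi; apply/eqP/negP => /eqP ai; move: adi; rewrite ai eqxx => /esym/eqP di.
      by have := ltn_trans (ltn_trans ab bc) cd; rewrite ai di ltnn.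
  exists v; split=> [|j k ji ki|]; last 2 first.
  - by rewrite vE -!(inj_eq val_inj) /= (ltn_eqF ji) (ltn_eqF ki).
  - apply/block_leastP => b; rewrite vE eqxx.
    by move=> /eqP/esym/eqP ->.
  have solo b : same y i b -> b == i.
    move=> ib; have := noD b; rewrite (yws _ _ ib) andbT -leqNgt => bi.
    by rewrite -(inj_eq val_inj) /= eqn_leq bi yi_min.
  apply/le_same => a b ab; rewrite vE; apply/eqP.
    apply/idP/idP => /eqP ei.
    by rewrite ei in ab; apply: solo.
  by rewrite ei same_sym in ab; apply: solo.
pose low a := [exists j : 'I_n, (j < i) && same y j a].
have lowP a : reflect (exists2 j : 'I_n, j < i & same y j a) (low a).
  by apply: (iffP existsP) => -[j]; [case/andP; exists j | exists j; apply/andP].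
have low_lt a : a < i -> low a by move=> ai; apply/lowP; exists a; rewrite ?same_refl.
have low_same a b : same y a b -> low a -> low b.
  by move=> ab /lowP[j ji ja]; apply/lowP; exists j => //; apply: same_trans ab.
have low_i : ~~ low i.
  apply/lowP => -[j ji]; rewrite same_sym => /yi_min.
  by rewrite leqNgt ji.
(* In [w], the block of [i] contains [q < i < D]; a block of [y] reaching from
   below [i] to beyond it would straddle or be straddled by it. *)
have low_ge a : low a -> i <= a -> same y q a.
  move=> la; rewrite leq_eqVlt => /predU1P[/val_inj ia|ia].
    by rewrite -ia (negPf low_i) in la.
  case/lowP: la => j ji ja; have [p [pj yp le_pj]] := ex_block_least y j.
  have pi := leq_ltn_trans le_pj ji.
  have wp := first_lost_rep yw fi yp pi.
  have pa := same_trans pj ja; have wpa := yws _ _ pa.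
  (* Both [p] and [q] are block minima of [w], so once joined in [w] they coincide. *)
  have join : same w p q -> same y q a by move/(block_least_inj wp wq) <-.
  have joini : same w p i -> same y q a.
    by move=> w_pi; apply: join; rewrite same_sym in qi; apply: same_trans qi.
  case: (ltngtP p q) => [pq|qp|/val_inj <-//].
    exact/join/(same_nonstraddling pq lt_qi ia wpa qi).
  have qD := same_trans qi wiD.
  case: (ltngtP a D) => [aD|Da|/val_inj aD].
  - apply: join; rewrite same_sym.
    exact: same_nonstraddling qp (ltn_trans pi ia) aD qD wpa.
  - exact/joini/(same_nonstraddling pi iD Da wpa wiD).
  - by apply: join; rewrite (same_left _ wpa) aD same_sym.
have [v vE] : exists v : NS n, same v =2 (fun a b => low a && low b || same y a b).
  apply: ex_NS => [a|a b|b a c|a b c d ab bc cd].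
  - by rewrite same_refl orbT.
  - by rewrite andbC same_sym.
  - case/orP=> [/andP[la lb]|yab] /orP[/andP[lb' lc]|ybc].
    + by rewrite la lc.
    + by rewrite la (low_same _ _ ybc lb).
    + by rewrite same_sym in yab; rewrite (low_same _ _ yab lb') lc.
    + by rewrite (same_trans yab ybc) orbT.
  (* In the mixed cases, low elements from [i] on lie in the [y]-block of [q] by [low_ge], which
     reduces the claim to non-straddling of [y]. *)
  - case/orP=> [/andP[la ld]|yad] /orP[/andP[lb lc]|ybc].
    + by rewrite la lb.
    + have [lb|lb] := boolP (low b); first by rewrite la.
      have ib : i <= b by rewrite leqNgt; apply: contraNN lb; apply: low_lt.
      have qd := low_ge d ld (leq_trans ib (ltnW (ltn_trans bc cd))).
      have qb := same_nonstraddling (leq_trans lt_qi ib) bc cd qd ybc.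
      by case/negP: lb; apply: (low_same q) => //; apply: low_lt.
    + have [la|la] := boolP (low a); first by rewrite lb.
      have ia : i <= a by rewrite leqNgt; apply: contraNN la; apply: low_lt.
      have ib := leq_trans ia (ltnW ab).
      have qb := low_ge b lb ib.
      have qc := low_ge c lc (leq_trans ib (ltnW bc)).
      rewrite (same_nonstraddling ab bc cd yad) //.
      by rewrite -(same_left _ qb).
    + by rewrite (same_nonstraddling ab bc cd yad) // orbT.
exists v; split=> [|j k ji ki|].
- by apply/le_same => a b yab; rewrite vE yab orbT.
- by rewrite vE !low_lt.
- apply/block_leastP => b; rewrite vE (negPf low_i) /=; exact: yi_min.
Qed.

(** * The first step of an increasing chain *)

(** In [u] the element [i] has a smaller block minimum [q]; nothing below [i] is lost, so [q] is
    still a minimum in [z] and must be [m]. *)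
Lemma least_join y u z i m :
    (y <= u)%O -> (u <= z)%O -> first_lost y z i -> ~~ block_least u i ->
  block_least z m -> same z m i -> same u m i.
Proof.
move=> yu uz fi /not_block_leastP[q [qi uq lt_qi]] zm mi.
have zq := first_lost_rep (le_trans yu uz) fi (refines_block_least yu uq) lt_qi.
have /le_same uzs := uz; suff <- : q = m by [].
apply: (block_least_inj zq zm); apply: (same_trans (uzs _ _ qi)).
by rewrite same_sym.
Qed.

(* The witness is the least [w >= y] in which [i] is joined to the minimum of
   its block in [z]. *)
Lemma ex_first_cover y z i : (y < z)%O -> first_lost y z i ->
  exists w, [/\ covers y w, (w <= z)%O & lost y w i].
Proof.
move=> yz fi; have [/andP[yi zi] i_min] := fi.
have /not_block_leastP[m [mi zm lt_mi]] := zi.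
pose good w := [&& (y <= w)%O, (w <= z)%O & same w m i].
have gz : good z by rewrite /good ltW // lexx.
case: (@arg_minnP _ z good (fun w => #|[pred x | (x <= w)%O]|) gz) => w gw w_min.
have {w_min}w_least x : (y <= x)%O -> (x <= w)%O -> same x m i -> x = w.
  move=> yx xw xmi; apply/eqP; apply: contraT => nxw.
  have gx : good x.
    by case/and3P: gw => _ wz _; rewrite /good yx xmi (le_trans xw wz).
  have := w_min x gx; rewrite leqNgt => /negP[]; apply: proper_card.
  apply/properP; split; first by apply/subsetP => t /le_trans; apply.
  exists w; rewrite !inE ?lexx //; apply: contraNN nxw => wx.
  by rewrite eq_le xw.
case/and3P: gw => yw wz wmi.
have wi : ~~ block_least w i.
  by apply/not_block_leastP; exists m; split=> //; apply: refines_block_least zm.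
exists w; split=> //; last by rewrite /lost yi.
have yw' : (y < w)%O.
  by rewrite lt_neqAle yw andbT; apply: contraNneq wi => <-.
rewrite /covers yw' /=; apply/existsPn => x; apply/negP => /andP[yx xw].
have [j fj] := ex_first_lost yx; have [lj _] := fj.
have lzj := lost_widen (lexx y) (le_trans (ltW xw) wz) lj.
have /andP[yj /not_block_leastP[q [xqj xq qj]]] := lj.
have xz := le_trans (ltW xw) wz.
(* If [j = i], then [x] already joins [m] and [i], against the minimality of [w]. *)
have := i_min j lzj; rewrite leq_eqVlt => /predU1P[/val_inj ij|lt_ij].
  have [/andP[_ xj] _] := fj; rewrite -ij in xj.
  have xmi := least_join (ltW yx) xz fi xj zm mi.
  by move: (xw); rewrite (w_least x) ?ltxx ?ltW.
(* If [i < j], the separator of [j] joins [m] and [i], so minimality makes its meet with [w] equal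
   to [w]. Then [v] joins [j] to the smaller [q], which is absurd. *)
have [v [/le_same yv v_low vj]] := separator (ltW yx) fj.
have [t tE] := ex_meet v w.
have tw : t = w.
  apply: w_least; last by rewrite tE wmi v_low // (ltn_trans lt_mi).
    by have /le_same yws := yw; apply/le_same => a b ab; rewrite tE yv ?yws.
  by apply/le_same => a b; rewrite tE => /andP[].
have /le_same/(_ _ _ xqj) := ltW xw; rewrite -tw tE => /andP[vqj _].
by move/block_leastP/(_ q): vj; rewrite same_sym vqj leqNgt qj => /(_ isT).
Qed.

(** * Structure and label of a cover *)

(** Keeping the [z]-block of [i] and cutting the other [z]-blocks back to blocks of [y] gives a
    non-straddling partition in [[y, z]] other than [y], hence [z]. So a cover creates just one new
    block. *)
Lemma cover_merge y z i a b : covers y z -> lost y z i ->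
  same z a b = same y a b || same z a i && same z b i.
Proof.
move=> yz /andP[yi /not_block_leastP[m [mi _ lt_mi]]].
have nymi : ~~ same y m i.
  apply/negP; rewrite same_sym => im.
  by move/block_leastP/(_ m im): yi; rewrite leqNgt lt_mi.
have /le_same yzs := ltW (cover_lt yz).
have zt c d e : same z c d -> same z d e -> same z c e by apply: same_trans.
have joined c d : same z c i -> same z d i -> same z c d.
  by move=> ci; rewrite same_sym; apply: zt.
have [x xE] :
  exists x : NS n, same x =2 (fun a b => same y a b || same z a i && same z b i).
  apply: ex_NS => [c|c d|d c e|a' b' c d ab bc cd].
  - by rewrite same_refl.
  - by rewrite same_sym andbC.
  - case/orP=> [ycd|/andP[ci di]] /orP[yde|/andP[di' ei]].
    + by rewrite (same_trans ycd yde).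
    + by rewrite ei (zt _ _ _ (yzs _ _ ycd) di') orbT.
    + by rewrite same_sym in yde; rewrite ci (zt _ _ _ (yzs _ _ yde) di) orbT.
    + by rewrite ci ei orbT.
  - case/orP=> [yad|/andP[ai di]] /orP[ybc|/andP[bi ci]].
    + by rewrite (same_nonstraddling ab bc cd).
    + have zab := same_nonstraddling ab bc cd (yzs _ _ yad) (joined _ _ bi ci).
      by rewrite bi (zt _ _ _ zab bi) orbT.
    + have zab := same_nonstraddling ab bc cd (joined _ _ ai di) (yzs _ _ ybc).
      by rewrite same_sym in zab; rewrite ai (zt _ _ _ zab ai) orbT.
    + by rewrite ai bi orbT.
rewrite -xE; suff -> : x = z by [].
apply: (cover_le_eq yz).
  rewrite lt_neqAle; apply/andP; split; last first.
    by apply/le_same => c d ycd; rewrite xE ycd.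
  by apply: contraNneq nymi => ->; rewrite xE mi same_refl orbT.
apply/le_same => c d; rewrite xE => /orP[/yzs//|/andP[]]; exact: joined.
Qed.

(** All merged blocks lie in the [z]-block of [i]. Their minima are the minimum [m] of that block
    and lost elements, so [i] comes second; the successor is the index shift of ['I_n]. *)
Lemma gamma_first_lost y z i : covers y z -> first_lost y z i ->
  gamma y z = Posz i.+1.
Proof.
move=> yz [li i_min]; have /andP[yi /not_block_leastP[m [mi zm lt_mi]]] := li.
have /block_leastP yi_min := yi.
have nymi : ~~ same y i m by apply: contraTN lt_mi => /yi_min; rewrite -leqNgt.
have ym := refines_block_least (ltW (cover_lt yz)) zm.
have in_labels p : block_least y p -> pblock (blocks y) p \notin blocks z ->
    p.+1 \in [seq block_min B | B in blocks y :\: blocks z].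
  move=> yp nz; apply/imageP; exists (pblock (blocks y) p); last first.
    by rewrite block_min_pblock.
  by rewrite inE nz pblock_block.
congr Posz; apply: (@kth_smallest_1 _ m.+1) => //.
- apply: in_labels => //; apply: contraNN nymi => zB.
  by rewrite same_sym /same -(same_block i zB (same_refl y m)).
- apply: in_labels => //; apply: contraNN nymi => zB.
  by rewrite /same -(same_block m zB (same_refl y i)) same_sym.
move=> _ /imageP[B /setDP[By Bz] ->].
have [b bB] := block_nonempty By.
have [p [pb yp _]] := ex_block_least y b.
have eB : B = pblock (blocks y) p.
  by rewrite -(def_pblock (trivIset_blocks y) By bB); apply/eqP; rewrite -sameE same_sym.
rewrite eB block_min_pblock //.
have zpi : same z p i.
  apply: contraNT Bz => npi; suff -> : B = pblock (blocks z) p by apply: pblock_block.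
  apply/setP => c; rewrite eB -/(same y p c) -/(same z p c).
  by rewrite (cover_merge p c yz li) (negPf npi) orbF.
have [zp|zp] := boolP (block_least z p); last by right; rewrite ltnS i_min // /lost yp.
left; congr S; congr nat_of_ord; apply: (block_least_inj zp zm).
by apply: (same_trans zpi); rewrite same_sym.
Qed.
(** Each cover joins [i] to the minimum of its [z]-block, a pair not joined in [y], so [cover_same]
    gives both inequalities. *)
Lemma first_cover_inj y z i w x : first_lost y z i ->
    covers y w -> (w <= z)%O -> lost y w i ->
    covers y x -> (x <= z)%O -> lost y x i ->
  w = x.
Proof.
move=> fi.
have half u t : covers y u -> (u <= z)%O -> lost y u i ->
    covers y t -> (t <= z)%O -> lost y t i -> (u <= t)%O.
  move=> yu uz /andP[yi ui] yt tz /andP[_ ti].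
  have [/andP[_ /not_block_leastP[m [mi zm lt_mi]]] _] := fi.
  apply: (@cover_same y u t m i yu (ltW (cover_lt yt))).
  - rewrite same_sym; apply: contraTN lt_mi => im.
    by rewrite -leqNgt; move/block_leastP: yi; apply.
  - exact: least_join (ltW (cover_lt yu)) uz fi ui zm mi.
  - exact: least_join (ltW (cover_lt yt)) tz fi ti zm mi.
by move=> yw wz lw yx xz lx; apply/le_anti/andP; split; apply: half.
Qed.

(** * Chains and the EL property *)

Lemma chain_cons y z u t : unrefinable_chain y z (u :: t) ->
  covers y u /\ unrefinable_chain u z t.
Proof. by rewrite /unrefinable_chain /= => /andP[/andP[-> ->] ->]. Qed.

Lemma chain_le y z t : unrefinable_chain y z t -> (y <= z)%O.
Proof.
elim: t y => [|u t IH] y; first by move=> /eqP <-.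
by case/chain_cons => /cover_lt/ltW yu /IH; apply: le_trans.
Qed.

Lemma chain_nil y t : unrefinable_chain y y t -> t = [::].
Proof.
case: t => // u t /chain_cons[/cover_lt yu /chain_le uy].
by have := lt_le_trans yu uy; rewrite ltxx.
Qed.

(** Some step loses [i], and no smaller element is lost there. *)
Lemma mem_labels y z t i : unrefinable_chain y z t -> first_lost y z i ->
  Posz i.+1 \in labels (@gamma n) y t.
Proof.
elim: t y => [|u t IH] y.
  by move=> /eqP <- [/andP[yi]]; rewrite yi.
case/chain_cons => yu ut [li i_min]; rewrite /= inE.
have [yleu ulez] := (ltW (cover_lt yu), chain_le ut).
rewrite (lost_split _ yleu ulez) in li; case/orP: li => li; apply/orP.
  left; rewrite (@gamma_first_lost y u i) //.
  by split=> // j lj; apply: i_min; apply: lost_widen lj.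
right; apply: IH => //; split=> // j lj; apply: i_min.
exact: lost_widen lj.
Qed.

Lemma first_lost_sub y u w z i j : (y <= u)%O -> (w <= z)%O ->
  first_lost y z i -> first_lost u w j -> i <= j.
Proof. by move=> yu wz [_ i_min] [lj _]; apply: i_min; apply: lost_widen lj. Qed.

(** The label of [i] occurs and no label is smaller, so weak increase puts it first. *)
Lemma increasing_head y z w t i : increasing_chain (@gamma n) y z (w :: t) ->
  first_lost y z i -> first_lost y w i.
Proof.
case/andP=> ch srt fi; have [yw wt] := chain_cons ch.
have [j fj] := ex_first_lost (cover_lt yw).
have := mem_labels ch fi; rewrite /= inE (gamma_first_lost yw fj).
have le_ij := first_lost_sub (lexx y) (chain_le wt) fi fj.
case/predU1P => [[ij]|mem_i]; first by rewrite (val_inj ij : i = j).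
have := allP (le_path_min srt) _ mem_i; rewrite (gamma_first_lost yw fj).
rewrite lez_nat ltnS => le_ji; suff -> : i = j by [].
by apply/val_inj/eqP; rewrite eqn_leq le_ij.
Qed.

Lemma increasing_behead y z w t : increasing_chain (@gamma n) y z (w :: t) ->
  increasing_chain (@gamma n) w z t.
Proof.
case/andP=> /chain_cons[_ ch] /path_sorted srt.
by rewrite /increasing_chain ch.
Qed.

(** The chain is shown strictly increasing, as interpolation requires, but unique among weakly
    increasing ones. *)
Lemma ex_increasing_chain y z : (y <= z)%O ->
  exists s,
    [/\ unrefinable_chain y z s, sorted (<%O) (labels (@gamma n) y s),
        forall t, increasing_chain (@gamma n) y z t -> t = s
      & forall t, unrefinable_chain y z t -> t <> s ->
          ((labels (@gamma n) y s : seqlexi int) < (labels (@gamma n) y t : seqlexi int))%O].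
Proof.
have [k] := ubnP #|[pred x | (y <= x)%O]|; elim: k y => // k IH y lt_k yz.
move: yz; rewrite le_eqVlt => /predU1P[<-|yz].
  exists [::]; split=> //; first by rewrite /unrefinable_chain /=.
    by move=> t /andP[/chain_nil].
  by move=> t /chain_nil ->.
have [i fi] := ex_first_lost yz; have [w [yw wz lw]] := ex_first_cover yz fi.
have fw : first_lost y w i.
  by split=> // j lj; have [_] := fi; apply; apply: lost_widen lj.
have gw := gamma_first_lost yw fw.
have [|s [ch srt uniq_s lex_s]] := IH w _ wz.
  rewrite -ltnS; apply: leq_trans lt_k; rewrite ltnS; apply: proper_card.
  apply/properP; split; first by apply/subsetP => x; apply/le_trans/ltW/cover_lt.
  by exists y; rewrite !inE ?lexx // lt_geF // cover_lt.
have head_w u : covers y u -> (u <= z)%O -> first_lost y u i -> u = w.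
  by move=> yu uz [lu _]; apply: (first_cover_inj fi).
exists (w :: s); split.
- by case/andP: ch => p l; rewrite /unrefinable_chain /= yw p.
- rewrite /= path_min_sorted //; case: s {uniq_s lex_s} ch srt => //= x s.
  case/chain_cons => wx xs /lt_path_min /allP srt.
  have [j fj] := ex_first_lost (cover_lt wx).
  (* Strict, because [i] is no longer a minimum in [w] and cannot be lost again. *)
  have lt_ij : (gamma y w < gamma w x)%O.
    rewrite gw (gamma_first_lost wx fj) ltz_nat ltnS ltn_neqAle.
    rewrite (first_lost_sub (ltW (cover_lt yw)) (chain_le xs) fi fj) andbT.
    have [/andP[wj _] _] := fj; have /andP[_ wi] := lw.
    by apply: contraNneq wi => /val_inj ->.
  by rewrite lt_ij; apply/allP => l /srt; apply: lt_trans.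
- case=> [/andP[/eqP /= yz' _]|u t inc]; first by rewrite yz' ltxx in yz.
  have /andP[/chain_cons[yu ut] _] := inc.
  have uw := head_w u yu (chain_le ut) (increasing_head inc fi).
  by rewrite uw in inc *; rewrite (uniq_s _ (increasing_behead inc)).
- case=> [/eqP /= yz'|u t]; first by rewrite yz' ltxx in yz.
  case/chain_cons => yu ut nt; rewrite ltxi_cons.
  have [j fj] := ex_first_lost (cover_lt yu).
  have le_ij := first_lost_sub (lexx y) (chain_le ut) fi fj.
  rewrite gw (gamma_first_lost yu fj) !lez_nat !ltnS le_ij /=.
  (* A competitor with the same first label also starts with [w], and the comparison passes to the
     tails. *)
  apply/implyP => le_ji; have ij : i = j.
    by apply/val_inj/eqP; rewrite eqn_leq le_ij.
  rewrite -ij in fj; have uw := head_w u yu (chain_le ut) fj.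
  by rewrite uw in ut nt *; apply: lex_s => // ts; apply: nt; rewrite ts.
Qed.

Lemma gamma_EL : EL_labelling (@gamma n).
Proof.
move=> y z /ltW /ex_increasing_chain[s [ch srt uniq_s lex_s]].
exists s; split=> //; rewrite /increasing_chain ch.
by apply: sub_sorted srt => ? ?; apply: ltW.
Qed.

(** * Interpolation *)

(** The step joins [i] to some [m < i]; both are below [k], so [v] joins them too and [cover_same]
    applies. *)
Lemma cover_below w x v i k : covers w x -> lost w x i -> (w <= v)%O ->
  (forall p q, p < k -> q < k -> same v p q) -> i < k -> (x <= v)%O.
Proof.
move=> wx /andP[wi /not_block_leastP[m [mi _ lt_mi]]] wv v_low ik.
apply: (@cover_same w x v m i) => //.
  rewrite same_sym; apply: contraTN lt_mi => im.
  by rewrite -leqNgt; move/block_leastP: wi; apply.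
by apply: v_low => //; apply: ltn_trans lt_mi ik.
Qed.

(* [v] is a separator for the cover [y, u], so the chain climbs inside [v] as
   long as its labels are below [a]; the step labelled [a] then lands above
   [u], hence at [z]. *)
Lemma last_label y u z v w a b s (l : int) :
    covers y u -> covers u z -> first_lost y u a -> first_lost u z b -> b < a ->
    (forall j k, j < a -> k < a -> same v j k) -> block_least v a ->
    (y <= w)%O -> (w <= v)%O -> ~~ block_least w b ->
    increasing_chain (@gamma n) w z s ->
  last l (labels (@gamma n) w s) = Posz a.+1.
Proof.
move=> yu uz fa fb ba v_low va; have [/andP[ya ua] _] := fa.
have zu := ltW (cover_lt uz).
elim: s w l => [|x s IH] w l yw wv wb inc.
  (* An empty chain would give [z <= v], leaving [a] a minimum in [u]; so the default [l] is never
     returned. *)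
  case/andP: inc => /eqP /= wz _; case/negP: ua.
  by apply: (refines_block_least zu); rewrite -wz; apply: refines_block_least wv va.
have wa : block_least w a by apply: refines_block_least wv va.
have /andP[/chain_cons[wx xs] _] := inc.
have wz := lt_le_trans (cover_lt wx) (chain_le xs).
have [i fi] := ex_first_lost wz; have fx := increasing_head inc fi.
have za : ~~ block_least z a.
  by apply: contraNN ua; apply: refines_block_least zu.
have le_ia : i <= a by have [_] := fi; apply; rewrite /lost wa.
have yx := le_trans yw (ltW (cover_lt wx)).
move: le_ia; rewrite leq_eqVlt => /predU1P[/val_inj ia|lt_ia] /=; last first.
  apply: IH (increasing_behead inc) => //; last first.
    by apply: contraNN wb; apply: refines_block_least (ltW (cover_lt wx)).
  have [lx _] := fx; exact: cover_below wx lx wv v_low lt_ia.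
rewrite ia in fi fx; have [q [uqa uq lt_qa]] := not_block_leastP _ _ ua.
have [m [mzq zm le_mq]] := ex_block_least z q.
have mza : same z m a by apply: (same_trans mzq); have /le_same := zu; apply.
have [/andP[_ xa] _] := fx.
have xma := least_join (ltW (cover_lt wx)) (chain_le xs) fi xa zm mza.
(* The [w]-minimum of [q] is below [a], hence survives in [z] and equals [m]. So [x] joins [q] and
   [a] through [m], as [u] does. *)
have xmq : same x m q.
  have [p [pq wp le_pq]] := ex_block_least w q.
  have zp := first_lost_rep (ltW wz) fi wp (leq_ltn_trans le_pq lt_qa).
  have /le_same wzs := ltW wz; have /le_same wxs := ltW (cover_lt wx).
  suff <- : p = m by apply: wxs.
  apply: (block_least_inj zp zm); apply: (same_trans (wzs _ _ pq)).
  by rewrite same_sym.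
have ux : (u <= x)%O.
  apply: (@cover_same y u x q a) => //.
    rewrite same_sym; apply: contraTN lt_qa => aq.
    by rewrite -leqNgt; move/block_leastP: ya; apply.
  by rewrite same_sym in xmq; apply: same_trans xma.
have xz : x = z.
  apply: (cover_le_eq uz) (chain_le xs); rewrite lt_neqAle ux andbT.
  (* The element [b] separates the two: it is a minimum in [u] but no longer in [w], hence not in
     [x]. *)
  apply: contraNneq wb => eux; have [/andP[ub _] _] := fb.
  by rewrite eux in ub; apply: refines_block_least (ltW (cover_lt wx)) ub.
rewrite xz in xs *; rewrite (chain_nil xs) /= -xz.
exact: gamma_first_lost.
Qed.

(** If the labels do not increase, [b] is the first element lost over the whole interval, so the
    increasing chain starts with its label. That first step stays below the separator of [a], and
    [last_label] handles the rest. *)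
Lemma gamma_interpolating : interpolating (@gamma n).
Proof.
move=> y u z yu uz; have [yu' uz'] := (cover_lt yu, cover_lt uz).
have [a fa] := ex_first_lost yu'; have [b fb] := ex_first_lost uz'.
rewrite (gamma_first_lost yu fa) (gamma_first_lost uz fb) ltz_nat ltnS.
case: (ltnP a b) => [|le_ba]; [by left | right].
have [/andP[ya ua] _] := fa; have [/andP[ub zb] _] := fb.
(* Equality fails: [b] is a block minimum of [u] and [a] is not. *)
have lt_ba : b < a.
  by rewrite ltn_neqAle le_ba andbT; apply: contraNneq ua => /val_inj <-.
have yb := refines_block_least (ltW yu') ub.
have fyz : first_lost y z b.
  split=> [|j]; first by rewrite /lost yb.
  rewrite (lost_split _ (ltW yu') (ltW uz')) => /orP[lj|lj].
    by have [_ a_min] := fa; apply: leq_trans le_ba (a_min _ lj).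
  by have [_] := fb; apply.
have yz := lt_trans yu' uz'.
have [s [ch srt _ _]] := ex_increasing_chain (ltW yz).
have inc : increasing_chain (@gamma n) y z s.
  by rewrite /increasing_chain ch; apply: sub_sorted srt => ? ?; apply: ltW.
case: s ch srt inc => [/eqP /= yz'|w s ch srt inc]; first by rewrite yz' ltxx in yz.
have [yw ws] := chain_cons ch; have fw := increasing_head inc fyz.
exists (w :: s) => //; split=> //=; first exact: gamma_first_lost.
have [v [yv v_low va]] := separator (ltW yu') fa.
have [lw _] := fw; have /andP[_ wb] := lw.
have wv := cover_below yw lw yv v_low lt_ba.
apply: (last_label _ yu uz fa fb lt_ba v_low va (ltW (cover_lt yw)) wv wb).
exact: increasing_behead inc.
Qed.
End Poset.

Theorem theorem5 (n : nat) (hn : (0 < n)%N) :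
  interpolating_EL_labelling (@gamma n).
Proof. by split; [apply: gamma_EL | apply: gamma_interpolating]. Qed.
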